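(* Let $n_x\ge 1$ be an integer and let $\mathrm{Pr}_{\mathbb W}$ be a probability distribution on $\mathbb R^{n_x}\times\mathbb R$, the distribution of a random vector $w=(x,y)$. Let $T:\mathbb R^{n_x}\to\mathbb R$ be a given (fixed, not depending on the samples below) measurable function, and let $\varepsilon\in(0,1)$ and $\delta\in(0,1)$. Let $N$ be an integer with $$N\ge\frac{7.47}{\varepsilon}\ln\frac1\delta ,\qquad\text{and let}\qquad r=\left\lfloor\frac{\varepsilon N}{2}\right\rfloor,$$ with $r\ge 1$. Draw $N$ i.i.d. samples $\{(x_i,y_i)\}_{i=1}^N$ from $\mathrm{Pr}_{\mathbb W}$, compute $q_i=|y_i-T(x_i)|$ for $i=1,\dots,N$, and let $$\rho=\mathrm{max}^{(r)}\{q_i\}_{i=1}^N .$$ Then, with probability no smaller than $1-\delta$ with respect to the draw of the $N$ samples, $$\mathrm{Pr}_{\mathbb W}\{|y-T(x)|>\rho\}\le\varepsilon.$$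
   Context: Generalized max: for a collection of $N$ scalars $\{q_i\}_{i=1}^N$ (counted with multiplicity) and an integer $1\le r\le N$, $\mathrm{max}^{(r)}\{q_i\}_{i=1}^N$ denotes the $r$-th largest value of the collection: $\mathrm{max}^{(1)}$ is the largest value, $\mathrm{max}^{(2)}$ the second largest, and so on, with $\mathrm{max}^{(N)}$ the smallest. In particular, no more than $r-1$ elements are strictly larger than it. The samples are i.i.d. with law $\mathrm{Pr}_{\mathbb W}$, so ''with probability no smaller than $1-\delta$'' refers to the product measure $\mathrm{Pr}_{\mathbb W}^{\otimes N}$ on the multisample. In the inner probability $\mathrm{Pr}_{\mathbb W}\{\cdot\}$, $(x,y)$ is a fresh random vector with law $\mathrm{Pr}_{\mathbb W}$ and $\rho$ is held fixed. *)

(* Defs.v *)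
From HB Require Import structures.
From mathcomp Require Import all_boot all_order all_algebra.
From mathcomp Require Import all_classical all_reals all_analysis.

Set Implicit Arguments.
Unset Strict Implicit.
Unset Printing Implicit Defensive.

Import Order.TTheory GRing.Theory Num.Theory.
Import numFieldNormedType.Exports.

Local Open Scope classical_set_scope.
Local Open Scope ring_scope.

(* [kth_max k s] is the generalized maximum max^(k) of the entries of [s],
   counted with multiplicity; [k] starts at 1, and the value is meaningful
   only for 1 <= k <= size s. *)
Definition kth_max (R : realType) (k : nat) (s : seq R) : R :=
  nth 0 (sort >=%R s) k.-1.

Section iid_law.
Context d (T : measurableType d) (R : realType).

Definition tuple_cons n (z : T * n.-tuple T) : n.+1.-tuple T :=
  [tuple of z.1 :: z.2].

Lemma measurable_tuple_cons n :
  measurable_fun [set: T * n.-tuple T] (@tuple_cons n).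
Proof. exact: measurable_cons. Qed.

HB.instance Definition _ n :=
  @isMeasurableFun.Build _ _ _ _ (@tuple_cons n) (@measurable_tuple_cons n).

(* The law P^{(x) n} of n independent draws from P: the image of P \x P^{(x) n-1}
   under the identification T * T^(n-1) = T^n. *)
Fixpoint iid_law (P : probability T R) (n : nat) : probability (n.-tuple T) R :=
  match n with
  | 0 => \d_ ([tuple] : 0.-tuple T)
  | m.+1 => distribution (P \x iid_law P m)%E (@tuple_cons m)
  end.

Lemma iid_law_box (P : probability T R) n (A : 'I_n -> set T) :
  (forall i, measurable (A i)) ->
  iid_law P n [set t | forall i, A i (tnth t i)] = (\prod_(i < n) P (A i))%E.
Proof.
elim: n A => [|n IHn] A mA.
  rewrite big_ord0 /= diracE mem_set//= => i; by case: i.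
rewrite big_ord_recl -IHn//= /distribution /pushforward.
rewrite -product_measure1E//; last first.
  rewrite [X in measurable X](_ : _ = \bigcap_(i in [set: 'I_n])
      ((fun t : n.-tuple T => tnth t i) @^-1` A (lift ord0 i))); last first.
    by apply/seteqP; split => t /= At i => [_|]; exact: At.
  apply: fin_bigcap_measurable => // i _; rewrite -[X in measurable X]setTI.
  exact: measurable_tnth.
congr (product_measure1 _ _ _); apply/seteqP; split => -[x t] /=.
- move=> At; split; first exact: (At ord0).
  by move=> i; have := At (lift ord0 i); rewrite tnthS.
- case=> Ax At i; case: (unliftP ord0 i) => [j ->|->//].
  by rewrite tnthS; exact: At.
Qed.

End iid_law.

(* Main.v *)
(* Let t be the infimum of the levels u with P(q > u) <= eps. By right
   continuity of the tail, P(q > u) <= eps iff t <= u, and P(q >= t) >= eps.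
   Hence the conclusion fails iff the r-th largest sample is below t, i.e. iff
   fewer than r samples satisfy q >= t: a lower-tail event for a binomial
   variable of mean at least eps * N, at or below half that bound since
   r <= eps * N / 2. The Chernoff bound at parameter 2/3 gives probability at
   most expR (- (100 / 747) * eps * N) <= delta. *)
Require Import Defs.
From HB Require Import structures.
From mathcomp Require Import all_boot all_order all_algebra.
From mathcomp Require Import all_classical all_reals all_analysis.
From mathcomp Require Import measurable_realfun lra ring.

Import Order.TTheory GRing.Theory Num.Theory.
Import numFieldNormedType.Exports.

Local Open Scope classical_set_scope.
Local Open Scope ring_scope.

(** In decreasing order the entries that are at least [t] form an initial segment, and the [k]-th
    entry lies in it exactly when its length is at least [k]. This turns an event about an order
    statistic into one about a count. *)
Lemma kth_max_ge (R : realType) (k : nat) (s : seq R) (t : R) :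
  (0 < k <= size s)%N ->
  (t <= kth_max k s) = (k <= count (fun x => (t <= x)%R) s)%N.
Proof.
case: k => // k /=; rewrite /kth_max /= -(count_sort >=%R) -(size_sort >=%R).
have: sorted >=%R (sort >=%R s).
  by apply: sort_sorted => x y; rewrite /= orbC le_total.
elim: (sort _ s) k => // x u IHu k xu ku.
have ux : all [pred y | y <= x] u.
  by apply: order_path_min xu => a b c ba ac; exact: le_trans ac ba.
have cu0 : x < t -> count (fun y => t <= y) u = 0%N.
  move=> xt; apply/eqP; rewrite -leqn0 leqNgt -has_count.
  by apply/hasPn => y /(allP ux) /= yx; rewrite -ltNge (le_lt_trans yx).
case: k ku => [|k] ku /=; last rewrite IHu ?(path_sorted xu)//.
  by have [//|/cu0 ->] := leP t x.
by have [//|/cu0 ->] := leP t x.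
Qed.

(* [2 / 3] approximates the optimal Chernoff parameter [ln 2]; the resulting
   exponent [22 / 47 - 1 / 3] exceeds [100 / 747]. *)
Lemma chernoff_half_mean (R : realType) (p eps delta : R) (N r : nat) :
  p <= 1 -> 0 < eps <= p -> 0 < delta -> r%:R <= eps * N%:R / 2 ->
  (747 / 100) / eps * ln (1 / delta) <= N%:R ->
  expR (2 / 3) ^+ r * (1 - p + p / expR (2 / 3)) ^+ N <= delta.
Proof.
move=> p1 /andP[eps0 epsp] delta0 hr hN.
set a : R := expR (2 / 3).
have a0 : 0 < a by exact: expR_gt0.
(* [47 / 25] lies just below [(10 / 9) ^+ 6]. Applying [1 + x <= expR x] directly at [2 / 3] would
   give only [5 / 3], too weak for the final constant. *)
have a_ge : 47 / 25 <= a.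
  have -> : a = expR (1 / 9) ^+ 6.
    by rewrite -expRM_natr; congr expR; field.
  have : (1 + 1 / 9) ^+ 6 <= expR (1 / 9 : R) ^+ 6.
    by rewrite lerXn2r ?nnegrE ?expR_ge0 ?expR_ge1Dx//; lra.
  apply: le_trans; lra.
have aV : a^-1 <= 25 / 47.
  by rewrite -[leRHS]invrK lef_pV2 ?posrE ?invf_div// divr_gt0.
have aV0 : 0 < a^-1 by rewrite invr_gt0.
have base0 : 0 <= 1 - p + p / a.
  by rewrite addr_ge0 ?subr_ge0// divr_ge0 ?ltW//; lra.
(* The left side decreases in [p], so [p] may be lowered to [eps]; [22 / 47] is [1 - 25 / 47]. *)
have base : 1 - p + p / a <= expR (- (eps * (22 / 47))).
  apply: le_trans (expR_ge1Dx _).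
  rewrite (_ : 1 - p + p / a = 1 - p * (1 - a^-1)); last by ring.
  by rewrite lerD2l lerN2 ler_pM//; lra.
have deltaE : ln (1 / delta) = - ln delta by rewrite div1r lnV// posrE.
have hN' : - ln delta <= eps * N%:R * (100 / 747).
  move: hN; rewrite deltaE mulrAC ler_pdivrMr//; lra.
rewrite -[leRHS](@lnK R)// (@le_trans _ _
    (expR (2 / 3 * r%:R) * expR (- (eps * (22 / 47)) * N%:R)))//.
  rewrite !expRM_natr ler_pM2l ?exprn_gt0//.
  by rewrite lerXn2r ?nnegrE// expR_ge0.
(* By [r <= eps * N / 2] the exponent is at most [eps * N] times [1 / 3 - 22 / 47]; then [hN']
   applies. *)
have : 0 <= eps * N%:R by rewrite mulr_ge0// ltW.
rewrite -expRD ler_expR mulNr (mulrAC eps); lra.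
Qed.

(* [R] is a parameter because the counting function is proved measurable as a
   sum of real-valued indicators. *)
Lemma measurable_count_le {d} {T : measurableType d} (R : realType) (A : set T)
    (n k : nat) :
  measurable A ->
  measurable [set w : n.-tuple T | (count (mem A) w <= k)%N].
Proof.
move=> mA.
pose c (w : n.-tuple T) : R := \sum_(i < n) \1_A (tnth w i).
have mc : measurable_fun setT c.
  apply: measurable_sum => i; apply: measurableT_comp (measurable_tnth i).
  exact: measurable_indic.
have cE w : c w = (count (mem A) w)%:R.
  rewrite -sum1_count big_mkcond big_tuple natr_sum; apply: eq_bigr => i _.
  by rewrite indicE; case: ifP => /= ->.
rewrite (_ : [set w | _] = c @^-1` `]-oo, k%:R]); last first.
  by apply/seteqP; split=> w /=; rewrite in_itv/= cE ler_nat.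
by rewrite -[X in measurable X]setTI; exact: mc.
Qed.

(* This is Markov's bound for [a ^- count]; induction on [n] avoids computing
   the expectation. *)
Lemma iid_law_count_le {d} {T : measurableType d} {R : realType}
    (P : probability T R) (A : set T) (a : R) (n k : nat) :
  measurable A -> 1 <= a ->
  (iid_law P n [set w : n.-tuple T | (count (mem A) w <= k)%N] <=
   (a ^+ k * (1 - fine (P A) + fine (P A) / a) ^+ n)%:E)%E.
Proof.
move=> mA a1; have a0 : 0 < a by exact: lt_le_trans a1.
(* [b] is the expectation of [a] to the power minus the indicator of [A]. *)
set p := fine (P A); set b := 1 - p + p / a.
have PA : P A = p%:E by rewrite fineK// fin_num_measure.
have PAC : P (~` A) = (1 - p)%:E by rewrite probability_setC// PA.
have p0 : 0 <= p by rewrite -lee_fin -PA.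
have p1 : 0 <= 1 - p by rewrite -lee_fin -PAC.
have b0 : 0 <= b by rewrite addr_ge0 ?divr_ge0 ?(ltW a0).
elim: n k => [|n IHn] k.
  rewrite expr0 mulr1 (le_trans (probability_le1 _ _))//.
    exact: (measurable_count_le R).
  by rewrite lee_fin exprn_ege1.
pose S j := [set w : n.-tuple T | (count (mem A) w <= j)%N].
have mS j : measurable (S j) by exact: (measurable_count_le R).
have PS (B : set T) (x : R) j : measurable B -> 0 <= x -> P B = x%:E ->
    ((P \x iid_law P n) (B `*` S j) <= (x * (a ^+ j * b ^+ n))%:E)%E.
  move=> mB x0 PB; rewrite product_measure1E// EFinM -PB.
  by apply: lee_wpmul2l => //; exact: IHn.
have consE x (w : n.-tuple T) :
    count (mem A) (tuple_cons (x, w)) = ((x \in A) + count (mem A) w)%N by [].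
rewrite /= /distribution /pushforward.
(* Condition on the first draw: a hit lowers the remaining allowance by one, a miss keeps it. With
   allowance zero only a miss is possible. *)
case: k => [|k].
  rewrite (_ : _ @^-1` _ = ~` A `*` S 0%N); last first.
    apply/seteqP; split=> -[x w]; rewrite /preimage /S /mkset consE.
      by have [//|/negP xA] := boolP (x \in A); split=> // /mem_set.
    by case=> xA; rewrite memNset.
  apply: (le_trans (PS _ _ _ _ p1 PAC)); first exact: measurableC.
  rewrite lee_fin !expr0 !mul1r exprS ler_wpM2r ?exprn_ge0//.
  by rewrite /b lerDl divr_ge0 // ltW.
rewrite (_ : _ @^-1` _ = A `*` S k `|` ~` A `*` S k.+1); last first.
  apply/seteqP; split=> -[x w]; rewrite /preimage /S /mkset consE.
    have [/set_mem xA|/negP xA] := boolP (x \in A); first by left.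
    by right; split=> // /mem_set.
  by case=> -[xA]; rewrite ?(mem_set xA) ?(memNset xA).
apply: (le_trans (measureU2 _ _ _)).
- exact: measurableX.
- by apply: measurableX => //; exact: measurableC.
apply: (le_trans (leeD (PS _ _ _ mA p0 PA) (PS _ _ _ (measurableC mA) p1 PAC))).
(* The two terms sum exactly to the bound, since [p * a ^+ k] is [a ^+ k.+1 * (p / a)]. *)
rewrite -EFinD lee_fin !exprS /b le_eqVlt; apply/orP; left; apply/eqP.
by field; rewrite gt_eqF.
Qed.

(** The equivalence replaces a condition on a random level by a comparison with the fixed number
    [t]. An atom at [t] is allowed, hence the closed half-line in the lower bound. *)
Lemma upper_quantile {d} {T : measurableType d} {R : realType}
    (P : probability T R) (X : {RV P >-> R}) (e : R) : 0 < e < 1 ->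
  exists t, (e%:E <= P [set z | (t <= X z)%R])%E /\
    forall u, (P [set z | (u < X z)%R] <= e%:E)%E = (t <= u).
Proof.
move=> /andP[e0 e1].
have ccdfE u : ccdf X u = P [set z | u < X z].
  rewrite /ccdf /distribution /pushforward; congr (P _).
  by apply/seteqP; split=> z /=; rewrite in_itv/= andbT.
pose E := [set u | (ccdf X u <= e%:E)%E].
have E0 : E !=set0.
  have : \forall u \near +oo%R, (ccdf X u < e%:E)%E.
    have e0E : (0 < e%:E)%E by rewrite lte_fin.
    exact: (cvg_ccdfy0 X (open_ereal_lt' e0E)).
  by case/filter_ex => u /ltW; exists u.
have Elb : has_lbound E.
  have : \forall u \near -oo%R, (e%:E < ccdf X u)%E.
    have e1E : (e%:E < 1)%E by rewrite lte_fin.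
    exact: (cvg_ccdfNy1 X (open_ereal_gt' e1E)).
  case/filter_ex => l el; exists l => u Eu; rewrite leNgt; apply/negP => ul.
  have := lt_le_trans el (ccdf_nonincreasing X (ltW ul)).
  by rewrite ltNge => /negP; apply.
(* Every level above the infimum belongs to [E] by monotonicity; right continuity passes the bound
   to the limit. *)
have Et : E (inf E).
  have : ccdf X u @[u --> (inf E)^'+] --> ccdf X (inf E).
    exact: ccdf_right_continuous.
  move/cvge_to_le; apply.
  near=> u; have : inf E < u by near: u; exact: nbhs_right_gt.
  move=> /(inf_lt E0)[v Ev vu].
  by apply: le_trans Ev; apply: ccdf_nonincreasing; exact: ltW.
exists (inf E); split; last first.
  move=> u; rewrite -ccdfE; apply/idP/idP => [Eu|tu]; first exact: ge_inf.
  by apply: le_trans Et; exact: ccdf_nonincreasing.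
(* These events decrease to [t <= X], and each has probability above [e] because its level lies
   below [inf E]. *)
pose F n := [set z | inf E - n.+1%:R^-1 < X z].
have mF n : measurable (F n).
  have -> : F n = X @^-1` `]inf E - n.+1%:R^-1, +oo[.
    by apply/seteqP; split=> z /=; rewrite in_itv/= andbT.
  exact: measurable_funPTI.
have -> : [set z | inf E <= X z] = \bigcap_n F n.
  apply/seteqP; split=> z /=.
    by move=> tX n _; apply: lt_le_trans tX; rewrite ltrBlDr ltrDl invr_gt0.
  move=> FX; apply/ler_addgt0Pr => x x0; rewrite -lerBlDr.
  have [n _ nx] := near_infty_natSinv_lt (PosNum x0).
  rewrite ltW// (le_lt_trans _ (FX n I))// lerD2l lerN2 ltW//.
  exact: (nx n (leqnn n)).
have : P (F n) @[n --> \oo] --> P (\bigcap_n F n).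
  apply: nonincreasing_cvg_mu => //.
  - by rewrite (le_lt_trans (probability_le1 _ _)) ?ltry.
  - exact: bigcap_measurable.
  - move=> m n mn; apply/subsetPset => z /=; apply: le_lt_trans.
    by rewrite lerD2l lerN2 lef_pV2 ?posrE// ler_nat.
move/cvge_to_ge; apply; near=> n.
rewrite /F -ccdfE ltW// ltNge; apply/negP => /(ge_inf Elb).
by rewrite leNgt ltrBlDr ltrDl invr_gt0 ltr0n.
Unshelve. all: by end_near. Qed.

Theorem corollary1 (R : realType) (nx : nat) (nx_ge1 : (1 <= nx)%N)
    (PrW : probability (nx.-tuple R * R)%type R)
    (T : nx.-tuple R -> R) (mT : measurable_fun [set: nx.-tuple R] T)
    (eps delta : R) (eps01 : 0 < eps < 1) (delta01 : 0 < delta < 1)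
    (N : nat) (hN : (747 / 100) / eps * ln (1 / delta) <= N%:R)
    (r : nat) (hr : r%:Z = Num.floor (eps * N%:R / 2)) (r_ge1 : (1 <= r)%N) :
  let q (w : nx.-tuple R * R) : R := `|w.2 - T w.1| in
  let rho (w : N.-tuple (nx.-tuple R * R)) : R :=
    kth_max r [seq q (tnth w i) | i <- enum 'I_N] in
  ((1 - delta)%:E <=
     iid_law PrW N [set w | PrW [set z | (rho w < q z)%R] <= eps%:E])%E.
Proof.
pose q (w : nx.-tuple R * R) : R := `|w.2 - T w.1|.
pose rho (w : N.-tuple (nx.-tuple R * R)) : R :=
  kth_max r [seq q (tnth w i) | i <- enum 'I_N].
change ((1 - delta)%:E <=
  iid_law PrW N [set w | PrW [set z | (rho w < q z)%R] <= eps%:E])%E.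
have /andP[eps0 eps1] := eps01; have /andP[delta0 _] := delta01.
have mq : measurable_fun setT q.
  apply: measurableT_comp => //; apply: measurable_funB => //.
  exact: measurableT_comp.
pose X : {RV PrW >-> R} := mfun_Sub (mem_set mq).
have [t [tA tE]] := upper_quantile _ X _ eps01.
pose A := [set z | t <= q z].
have mA : measurable A.
  have -> : A = q @^-1` `[t, +oo[.
    by apply/seteqP; split=> z /=; rewrite in_itv/= andbT.
  by rewrite -[S in measurable S]setTI; exact: (mq measurableT).
have rN2 : r%:R <= eps * N%:R / 2.
  by have := floor_le_tmp (eps * N%:R / 2); rewrite -hr.
(* This keeps the index of [kth_max] in range. *)
have rN : (r <= N)%N.
  rewrite -(ler_nat R) (le_trans rN2)// ler_pdivrMr// mulrC ler_wpM2l//; lra.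
(* The good event says that at least [r] samples fall in [A], so its complement allows at most
   [r.-1]. *)
have goodE : [set w | (PrW [set z | (rho w < q z)%R] <= eps%:E)%E] =
    ~` [set w : N.-tuple _ | (count (mem A) w <= r.-1)%N].
  apply/seteqP.
  suff H w : (PrW [set z | (rho w < q z)%R] <= eps%:E)%E =
      ~~ (count (mem A) w <= r.-1)%N.
    by split=> w /=; rewrite H => /negP.
  rewrite (tE (rho w)) kth_max_ge; last first.
    by rewrite size_map size_enum_ord r_ge1.
  rewrite -ltnNge prednK// map_comp map_tnth_enum count_map; congr (_ <= _)%N.
  by apply: eq_count => z /=; apply/idP/idP => [/mem_set|/set_mem].
rewrite goodE probability_setC; last exact: (measurable_count_le R).
rewrite EFinB leeD2l// leeN2.
apply: (le_trans (iid_law_count_le PrW A (expR (2 / 3)) N r.-1 mA _)).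
  by rewrite -expR0 ler_expR.
rewrite lee_fin; apply: (@chernoff_half_mean _ _ eps) => //.
- by rewrite -lee_fin fineK ?fin_num_measure// probability_le1.
- by rewrite eps0 -lee_fin fineK ?fin_num_measure.
- by rewrite (le_trans _ rN2)// ler_nat leq_pred.
Qed.
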